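(* Let $V$ be a $4$-dimensional $\mathbf{k}$-vector space. For $Q_1,Q_2,Q_3,Q_4\in S^2V^*$ one has an equality in $\det(V^* )\otimes S^4(V^* )$, $$[\Pi_{Q_1=Q_2=0},\Pi_{Q_3=Q_4=0}]=4\cdot\Phi(Q_1\wedge Q_2\wedge Q_3\wedge Q_4).$$
   Context: Work over an algebraically closed field $\mathbf{k}$ of characteristic $0$; $\mathbb{P}^3=\mathbb{P}V$ is the projective space of lines in $V$, and $\det(V^* )=\bigwedge^4V^*$. The map $\Phi$: $\Phi:\bigwedge^4(S^2V^* )\to\det(V^* )\otimes S^4(V^* )$ is the linear map sending $Q_1\wedge Q_2\wedge Q_3\wedge Q_4$ to the degree $4$ polynomial map on $V$ with values in $\det(V^* )$, $v\mapsto(\partial_vQ_1)\wedge(\partial_vQ_2)\wedge(\partial_vQ_3)\wedge(\partial_vQ_4)$, where $\partial_vQ\in V^*$ is the derivative of the quadratic form $Q$ in the direction $v$. The normalized bivector: $\Pi_{Q_1=Q_2=0}\in\det(V^* )\otimes H^0(\mathbb{P}V,\bigwedge^2T_{\mathbb{P}V})$ is the bivector on $\mathbb{P}V$ induced (via degree $0$ homogeneous rational functions) by the quadratic Poisson bracket on $S(V^* )$ given on linear forms by $\{\ell_1,\ell_2\}=(d\ell_1\wedge d\ell_2\wedge dQ_1\wedge dQ_2)/\mathrm{vol}$, where $\mathrm{vol}$ is a generator of $\det(V^* )$ (the choice of $\mathrm{vol}$ being accounted for by the factor $\det(V^* )$). When $Q_1=Q_2=0$ is a smooth elliptic curve $E$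 this is the Feigin–Odesskii Poisson bivector associated with $E\subset\mathbb{P}^3$, which in general is defined only up to rescaling. The Schouten bracket of two such bivectors lies in $(\det V^* )^{\otimes 2}\otimes H^0(\mathbb{P}V,\bigwedge^3T_{\mathbb{P}V})$, which is identified with $\det(V^* )\otimes S^4(V^* )$ via $\bigwedge^3T_{\mathbb{P}V}\simeq\det(V)\otimes\mathcal{O}_{\mathbb{P}V}(4)$ (from the Euler sequence). Explicitly, choose coordinates $x_1,\dots,x_4$ on $V$, trivialize $\det(V^* )$ by $\mathrm{vol}=x_1\wedge x_2\wedge x_3\wedge x_4$, and put $y_i=x_i/x_1$ for $i=2,3,4$; then the trivector $\partial_{y_2}\wedge\partial_{y_3}\wedge\partial_{y_4}$ corresponds to the quartic $x_1^4$. Normalization and sign of the Schouten bracket of bivectors: if $\Pi_1,\Pi_2$ have brackets $\{\cdot,\cdot\}_1,\{\cdot,\cdot\}_2$, then $[\Pi_1,\Pi_2]$ is the trivector whose value on $df\wedge dg\wedge dh$ is $\sum_{\mathrm{cyc}(f,g,h)}\big(\{\{f,g\}_1,h\}_2+\{\{f,g\}_2,h\}_1\big)$, where $\partial_{y_2}\wedge\partial_{y_3}\wedge\partial_{y_4}$ has value $1$ on $dy_2\wedge dy_3\wedge dy_4$. *)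

(* Defs.v *)
From mathcomp Require Import all_boot all_order all_algebra ring.
From mathcomp Require Import generic_quotient mpoly.

Set Implicit Arguments.
Unset Strict Implicit.
Unset Printing Implicit Defensive.

Import GRing.Theory.
Local Open Scope ring_scope.
Local Open Scope quotient_scope.

Notation "x %:F" := (@FracField.tofrac _ x) : ring_scope.

Section Forms.
Context {k : fieldType} {V : vectType k}.
Implicit Types (Q : V -> k) (e : 4.-tuple V) (p : {mpoly k[4]}).

Definition polar Q (v w : V) : k := Q (v + w) - Q v - Q w.

(* Elements of S^2(V^* ) are quadratic forms on V.                            *)
Definition quadratic_form Q : Prop :=
  (forall a v, Q (a *: v) = a ^+ 2 * Q v) /\
  (forall a u v w, polar Q (a *: u + v) w = a * polar Q u w + polar Q v w).

(* A basis e of V gives linear coordinates x_i = coord e i on V, the          *)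
(* generator vol = x_1 /\ x_2 /\ x_3 /\ x_4 of det(V^* ), and an isomorphism  *)
(* of {mpoly k[4]} with S(V^* ) sending 'X_i to x_i.                          *)
Definition polyfun e p (v : V) : k := p.@[fun i => coord e i v].

(* Q in the coordinates x_i; this uses that 2 is invertible in k.             *)
Definition quad_poly e Q : {mpoly k[4]} :=
  2%:R^-1 *: \sum_(i < 4) \sum_(j < 4)
     polar Q (tnth e i) (tnth e j) *: ('X_i * 'X_j).

Definition dir_deriv e (v : V) p : {mpoly k[4]} :=
  \sum_(i < 4) coord e i v *: p^`M(i).

(* The linear forms l_a satisfy l_1 /\ l_2 /\ l_3 /\ l_4 = wedge_lin l * vol. *)
Definition wedge_lin (l : 4.-tuple {mpoly k[4]}) : k :=
  \det (\matrix_(a < 4, b < 4) (tnth l a)@_U_(b)).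

(* The quartic v |-> (d_v Q1 /\ d_v Q2 /\ d_v Q3 /\ d_v Q4) / vol. The (a, b) *)
(* entry below is the coefficient of x_b in d_v Q_a at the generic vector     *)
(* v = \sum_i 'X_i e_i; see polyfun_Phi.                                      *)
Definition Phi e Q1 Q2 Q3 Q4 : {mpoly k[4]} :=
  \det (\matrix_(a < 4, b < 4) \sum_(i < 4)
     ((tnth [tuple quad_poly e Q1; quad_poly e Q2; quad_poly e Q3;
                   quad_poly e Q4] a)^`M(i))@_U_(b) *: 'X_i).

Lemma quad_poly_homog e Q : quad_poly e Q \is 2.-homog.
Proof.
apply/dhomogZ/rpred_sum => i _; apply: rpred_sum => j _; apply: dhomogZ.
by apply: (@dhomogM _ _ _ 1 _ 1); rewrite dhomogX; apply/eqP; exact: mdeg1.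
Qed.

Lemma polarC Q v w : polar Q v w = polar Q w v.
Proof. by rewrite /polar (addrC v w) addrAC. Qed.

Lemma polyfun_quad_poly e Q v : 2%:R != 0 :> k -> basis_of fullv e ->
  quadratic_form Q -> polyfun e (quad_poly e Q) v = Q v.
Proof.
move=> two_neq0 be [QZ QD].
have polar0 w : polar Q 0 w = 0.
  have := QD (-1) 0 0 w; rewrite scaler0 addr0 mulN1r addNr; exact.
have polar_sum (c : 'I_4 -> k) (w : V) (r : seq 'I_4) :
    polar Q (\sum_(i <- r) c i *: tnth e i) w
    = \sum_(i <- r) c i * polar Q (tnth e i) w.
  elim: r => [|i r IHr]; first by rewrite !big_nil polar0.
  by rewrite !big_cons QD IHr.
have polar_v w : polar Q v w = \sum_(i < 4) coord e i v * polar Q (tnth e i) w.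
  rewrite {1}(coord_basis be (memvf v)) -polar_sum; congr polar.
  by apply: eq_bigr => i _; rewrite (tnth_nth 0).
have polar_vv : polar Q v v = 2%:R * Q v.
  have -> : polar Q v v = Q (2%:R *: v) - Q v - Q v.
    by rewrite /polar scaler_nat mulr2n.
  by rewrite QZ; ring.
apply: (mulfI two_neq0); rewrite -polar_vv /polyfun /quad_poly mevalZ mulrA.
rewrite mulfV // mul1r polar_v raddf_sum /=; apply: eq_bigr => i _.
rewrite polarC polar_v mulr_sumr raddf_sum /=; apply: eq_bigr => j _.
by rewrite mevalZ mevalM !mevalXU polarC; ring.
Qed.

Lemma polyfun_Phi e Q1 Q2 Q3 Q4 v :
  polyfun e (Phi e Q1 Q2 Q3 Q4) v =
  wedge_lin [tuple of map (dir_deriv e v) [tuple quad_poly e Q1; quad_poly e Q2;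
                                           quad_poly e Q3; quad_poly e Q4]].
Proof.
rewrite /polyfun /Phi -det_map_mx; congr (\det _); apply/matrixP=> a b.
rewrite !mxE tnth_map /dir_deriv !raddf_sum /=; apply: eq_bigr => i _.
by rewrite mevalZ mevalXU mcoeffZ mulrC.
Qed.

Lemma Phi_homog e Q1 Q2 Q3 Q4 : Phi e Q1 Q2 Q3 Q4 \is 4.-homog.
Proof.
apply: rpred_sum => s _; rewrite -signr_odd.
have prod_homog n (F : 'I_n -> {mpoly k[4]}) :
    (forall i, F i \is 1.-homog) -> \prod_(i < n) F i \is n.-homog.
  elim: n F => [|n IHn] F homF; first by rewrite big_ord0 dhomog1.
  by rewrite big_ord_recl; apply: (@dhomogM _ _ _ 1) => //; apply: IHn.
rewrite mulr_sign; set P := \prod_i _.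
have homP : P \is 4.-homog.
  apply: prod_homog => i; rewrite mxE; apply: rpred_sum => j _.
  by apply: dhomogZ; rewrite dhomogX; apply/eqP; exact: mdeg1.
by case: ifP => _; rewrite ?rpredN.
Qed.

End Forms.

Section RationalFunctions.
Context {k : fieldType}.
Local Notation S := {mpoly k[4]}.
Local Notation K := {fraction S}.
Implicit Types (p q : S) (f g h : K).

(* The derivation d/dx_i of S, extended to K by the quotient rule.            *)
Definition frac_deriv (i : 'I_4) f : K :=
  let n := \n_(repr f) in let d := \d_(repr f) in
  (n^`M(i) * d - n * d^`M(i))%:F / (d ^+ 2)%:F.

Lemma numden_repr f : f = (\n_(repr f))%:F / (\d_(repr f))%:F.
Proof.
have d0 : \d_(repr f) != 0 by apply: denom_ratioP.
rewrite -[LHS]reprK -[in LHS](Ratio_numden (repr f)); unlock FracField.tofrac.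
rewrite -[X in _ * X]FracField.pi_inv -[RHS]FracField.pi_mul.
by rewrite /FracField.mulf /FracField.invf /= !numden_Ratio ?oner_neq0 // mulr1 mul1r.
Qed.

Lemma frac_derivE i p q : q != 0 ->
  frac_deriv i (p%:F / q%:F) = (p^`M(i) * q - p * q^`M(i))%:F / (q ^+ 2)%:F.
Proof.
move=> q0; rewrite /frac_deriv; set r := repr _.
have d0 : \d_r != 0 by apply: denom_ratioP.
have : \n_r * q = p * \d_r.
  apply/eqP; rewrite -tofrac_eq !tofracM -eqr_div ?tofrac_eq0 //.
  by rewrite -numden_repr.
move: \n_r \d_r d0 => n d d0 E.
have E' := congr1 (mderiv i) E; rewrite !mderivM in E'.
apply/eqP; rewrite eqr_div ?tofrac_eq0 ?expf_eq0 // -!tofracM tofrac_eq.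
apply/eqP.
have -> : (n^`M(i) * d - n * d^`M(i)) * q ^+ 2 =
  d * q * (n^`M(i) * q + n * q^`M(i)) - d * q^`M(i) * (n * q) - d^`M(i) * q * (n * q) by ring.
by rewrite E' E; ring.
Qed.

Lemma frac_deriv_tofrac i p : frac_deriv i p%:F = (p^`M(i))%:F.
Proof.
rewrite -[p%:F]divr1 -tofrac1 frac_derivE ?oner_neq0 // expr1n -mpolyC1.
by rewrite mderivC mulr0 subr0 mulr1 mpolyC1 tofrac1 divr1.
Qed.

Lemma mderivXU i j : ('X_i : S)^`M(j) = (i == j)%:R.
Proof.
rewrite mderivX mnm1E; case: eqP => [->|_]; last by rewrite scale0r.
by rewrite scale1r -[X in (X - _)%MM]add0m addmK mpolyX0.
Qed.

(* dp_1 /\ dp_2 /\ dp_3 /\ dp_4 = wedge_d p * vol.                            *)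
Definition wedge_d (p : 4.-tuple S) : S :=
  \det (\matrix_(a < 4, b < 4) (tnth p a)^`M(b)).

(* The biderivation of K with {x_i, x_j} = dx_i /\ dx_j /\ dq1 /\ dq2 / vol.  *)
Definition bracket q1 q2 f g : K :=
  \sum_(i < 4) \sum_(j < 4)
    frac_deriv i f * frac_deriv j g * (wedge_d [tuple 'X_i; 'X_j; q1; q2])%:F.

Lemma bracket_tofrac q1 q2 p1 p2 :
  bracket q1 q2 p1%:F p2%:F = (wedge_d [tuple p1; p2; q1; q2])%:F.
Proof.
have expand a (t : S -> 4.-tuple S) :
    (forall r, tnth (t r) a = r) ->
    (forall r r' i, i != a -> tnth (t r) i = tnth (t r') i) ->
  forall r, wedge_d (t r) = \sum_(i < 4) r^`M(i) * wedge_d (t 'X_i).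
  move=> ta tN r; pose c i := cofactor (\matrix_(a, b) (tnth (t r) a)^`M(b)) a i.
  have detE r' : wedge_d (t r') = \sum_(i < 4) r'^`M(i) * c i.
    rewrite /wedge_d (expand_det_row _ a); apply: eq_bigr => i _.
    rewrite mxE ta; congr (_ * (_ * \det _)); apply/matrixP => u v.
    by rewrite !mxE (tN r' r) // eq_sym neq_lift.
  rewrite detE; apply: eq_bigr => i _; congr (_ * _).
  rewrite detE (bigD1 i) //= big1 => [|j ji]; first by rewrite mderivXU eqxx mul1r addr0.
  by rewrite mderivXU eq_sym (negPf ji) mul0r.
have exp0 r2 := expand ord0 (fun r => [tuple r; r2; q1; q2]).
have exp1 r1 := expand (lift ord0 ord0) (fun r => [tuple r1; r; q1; q2]).
rewrite exp0; [|done|by move=> r r' [[|[|[|[|?]]]] ?]].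
rewrite raddf_sum; apply: eq_bigr => i _.
rewrite exp1; [|done|by move=> r r' [[|[|[|[|?]]]] ?]].
rewrite mulr_sumr raddf_sum; apply: eq_bigr => j _.
by rewrite !frac_deriv_tofrac -!tofracM mulrA.
Qed.

(* Rational functions on P(V): quotients of two forms of the same degree.     *)
Definition degree0 f : Prop := exists (d : nat) (p q : S),
  [/\ p \is d.-homog, q \is d.-homog, q != 0 & f = p%:F / q%:F].

(* y_2, y_3, y_4, where y_i = x_i / x_1; the index of x_1 is ord0 : 'I_4.     *)
Definition affine_coord (i : 'I_3) : K := ('X_(lift ord0 i))%:F / ('X_ord0)%:F.

(* On degree0 fractions these are d/dy_2, d/dy_3, d/dy_4.                     *)
Definition affine_deriv (i : 'I_3) f : K :=
  ('X_ord0)%:F * frac_deriv (lift ord0 i) f.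

Lemma affine_deriv_coord i j :
  affine_deriv i (affine_coord j) = (i == j)%:R.
Proof.
have X0 : 'X_ord0 != 0 :> S by rewrite -msize_poly_eq0 msizeX mdeg1.
rewrite /affine_deriv /affine_coord frac_derivE // !mderivXU eq_sym (inj_eq lift_inj).
rewrite (negPf (neq_lift ord0 i)) mulr0 subr0.
have XF : ('X_ord0)%:F != 0 :> K by rewrite tofrac_eq0.
case: eqP => _; last by rewrite mul0r tofrac0 mul0r mulr0.
rewrite (_ : _ * 'X_ord0 = 'X_ord0); last exact: mul1r.
rewrite [LHS]mulrA -tofracM -expr2.
have X2F : ('X_ord0 ^+ 2)%:F != 0 :> K by rewrite tofrac_eq0; exact: expf_neq0.
exact: (divff X2F).
Qed.

(* Bivectors and trivectors on P(V) are represented by their values on df /\ dg *)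
(* and df /\ dg /\ dh, for rational functions f, g, h on P(V).                *)

Definition schouten (B1 B2 : K -> K -> K) f g h : K :=
  (B2 (B1 f g) h + B1 (B2 f g) h) +
  (B2 (B1 g h) f + B1 (B2 g h) f) +
  (B2 (B1 h f) g + B1 (B2 h f) g).

(* T = F / x_1^4 * d/dy_2 /\ d/dy_3 /\ d/dy_4.                                *)
Definition corresponds_to_quartic (T : K -> K -> K -> K) (F : S) : Prop :=
  F \is 4.-homog /\
  forall f g h, degree0 f -> degree0 g -> degree0 h ->
    T f g h = F%:F / ('X_ord0 ^+ 4)%:F *
      \det (\matrix_(a < 3, b < 3) affine_deriv b (tnth [tuple f; g; h] a)).

End RationalFunctions.

(* The component along vol of the bivector on P(V) defined by Q1 and Q2.      *)
Definition Pi {k : fieldType} {V : vectType k} (e : 4.-tuple V)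
    (Q1 Q2 : V -> k) : {fraction {mpoly k[4]}} -> {fraction {mpoly k[4]}} ->
    {fraction {mpoly k[4]}} :=
  bracket (quad_poly e Q1) (quad_poly e Q2).

(* Main.v *)
Require Import Defs.
From mathcomp Require Import all_boot all_order all_algebra ring.
From mathcomp Require Import mpoly.

Import GRing.Theory.
Local Open Scope ring_scope.

(* The bivector of q1, q2 is dual, with respect to vol, to the closed 2-form  *)
(* dq1 /\ dq2, so on affine space the Schouten bracket of two of them is the  *)
(* trivector dual to -dF, where F vol = dq1 /\ dq2 /\ dq3 /\ dq4: its value   *)
(* on f, g, h is minus the Jacobian of f, g, h, F. If f, g, h are homogeneous *)
(* of degree 0 then df /\ dg /\ dh is a multiple of the contraction of vol    *)
(* with the Euler field, so only the Euler derivative of F matters; it is 4F  *)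
(* since F is a quartic, which is where the factor 4 comes from.              *)

Local Notation o0 := (@ord0 3).
Local Notation o1 := (lift ord0 (@ord0 2)).
Local Notation o2 := (lift ord0 (lift ord0 (@ord0 1))).
Local Notation o3 := (lift ord0 (lift ord0 (lift ord0 (@ord0 0)))).

(** Everything reduces to one polynomial, the Jacobian determinant F of the four quadrics. The
    bracket on affine space is computed in any commutative ring with four commuting derivations:
    second derivatives of the arguments cancel ([schouten_biderivation]), and the remaining
    coefficients are signed derivatives of F ([schouten_coefE]), which gives [schouten_jacobian].
    [frac_derivD], [frac_derivM] and [frac_derivC] make this available on the fraction field.
    Arguments of degree 0 are killed by the Euler field, so [det4_euler] leaves only 4F times a 3 by
    3 minor ([schouten_bracket_quartic]). Finally F is [Phi], because a quadratic form has linear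
    partial derivatives and a symmetric Hessian ([Phi_wedge_d]). *)

(** * Explicit determinants of size at most four *)

(** Entries are indexed by [nat] so that each minor is again a matrix of the same shape and the
    expansion can be iterated. *)
Lemma det_row_recl {R : comPzRingType} {n} (A : nat -> nat -> R) :
  \det (\matrix_(i < n.+1, j < n.+1) A i j) =
  \sum_(j < n.+1) (-1) ^+ j * A 0%N j *
     \det (\matrix_(i < n, l < n) A i.+1 (bump j l)).
Proof.
rewrite (expand_det_row _ ord0); apply: eq_bigr => j _.
rewrite mxE /cofactor add0n mulrCA mulrA; congr (_ * \det _).
by apply/matrixP=> u v; rewrite !mxE.
Qed.

Lemma det2_nat {R : comPzRingType} (A : nat -> nat -> R) :
  \det (\matrix_(i < 2, j < 2) A i j) =
  A 0%N 0%N * A 1%N 1%N - A 0%N 1%N * A 1%N 0%N.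
Proof.
rewrite det_row_recl.
under eq_bigr => j _ do
  rewrite (det_row_recl (n := 0) (fun i l => A i.+1 (bump j l)))
    big_ord1 det_mx00.
by rewrite !big_ord_recl big_ord0 /= /bump /=; ring.
Qed.

Lemma det3_nat {R : comPzRingType} (A : nat -> nat -> R) :
  \det (\matrix_(i < 3, j < 3) A i j) =
    A 0%N 0%N * (A 1%N 1%N * A 2%N 2%N - A 1%N 2%N * A 2%N 1%N)
  - A 0%N 1%N * (A 1%N 0%N * A 2%N 2%N - A 1%N 2%N * A 2%N 0%N)
  + A 0%N 2%N * (A 1%N 0%N * A 2%N 1%N - A 1%N 1%N * A 2%N 0%N).
Proof.
rewrite det_row_recl.
under eq_bigr => j _ do rewrite (det2_nat (fun i l => A i.+1 (bump j l))).
by rewrite !big_ord_recl big_ord0 /= /bump /=; ring.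
Qed.

Definition minor3 {R : comPzRingType} {n} (u v w : 'I_n -> R)
    (i j l : 'I_n) : R :=
  u i * (v j * w l - v l * w j) - u j * (v i * w l - v l * w i)
  + u l * (v i * w j - v j * w i).

Lemma det3E {R : comPzRingType} (u v w : 'I_3 -> R) :
  \det (\matrix_(a, b) tnth [tuple u; v; w] a b) =
  minor3 u v w ord0 (lift ord0 ord0) (lift ord0 (lift ord0 ord0)).
Proof.
pose A a b : R := nth (fun=> 0) [:: u; v; w] a (inord b).
transitivity (\det (\matrix_(a < 3, b < 3) A a b)).
  congr (\det _); apply/matrixP=> a b.
  by rewrite !mxE /A inord_val (tnth_nth (fun=> 0)).
rewrite det3_nat /A /= /minor3.
have -> : lift ord0 (lift ord0 ord0) = inord 2 :> 'I_3.
  by apply/val_inj; rewrite /= inordK.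
have -> : lift ord0 ord0 = inord 1 :> 'I_3 by apply/val_inj; rewrite /= inordK.
by have -> : ord0 = inord 0 :> 'I_3 by apply/val_inj; rewrite /= inordK.
Qed.

Lemma det4E {R : comPzRingType} (u v w x : 'I_4 -> R) :
  \det (\matrix_(a, b) tnth [tuple u; v; w; x] a b) =
    u o0 * minor3 v w x o1 o2 o3 - u o1 * minor3 v w x o0 o2 o3
  + u o2 * minor3 v w x o0 o1 o3 - u o3 * minor3 v w x o0 o1 o2.
Proof.
pose A a b : R := nth (fun=> 0) [:: u; v; w; x] a (inord b).
have -> : \matrix_(a, b) tnth [tuple u; v; w; x] a b =
    \matrix_(a < 4, b < 4) A a b.
  apply/matrixP=> a b.
  by rewrite !mxE /A inord_val (tnth_nth (fun=> 0)).
rewrite det_row_recl.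
under eq_bigr => j _ do rewrite (det3_nat (fun i l => A i.+1 (bump j l))).
rewrite !big_ord_recl big_ord0 /= /bump /= /A /= /minor3.
have -> : o3 = inord 3 by apply/val_inj; rewrite /= inordK.
have -> : o2 = inord 2 by apply/val_inj; rewrite /= inordK.
have -> : o1 = inord 1 by apply/val_inj; rewrite /= inordK.
have -> : o0 = inord 0 by apply/val_inj; rewrite /= inordK.
ring.
Qed.

(** * Schouten brackets of biderivations *)

Definition biderivation {R : comPzRingType} {n} (D : 'I_n -> R -> R)
    (P : 'I_n -> 'I_n -> R) (f g : R) : R :=
  \sum_(i < n) \sum_(j < n) D i f * D j g * P i j.

(* In biderivation D P' (biderivation D P f g) h the outer derivation hits    *)
(* either the coefficients of P (deriv_coef) or one of the inner arguments    *)
(* (deriv_arg, symmetric under exchanging (P, g) with (P', h)).               *)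
Definition deriv_coef {R : comPzRingType} {n} (D : 'I_n -> R -> R)
    (P P' : 'I_n -> 'I_n -> R) (f g h : R) : R :=
  \sum_(i < n) \sum_(j < n) \sum_(l < n) \sum_(m < n)
    D i f * D j g * D l h * (D m (P i j) * P' m l).

Definition deriv_arg {R : comPzRingType} {n} (D : 'I_n -> R -> R)
    (P P' : 'I_n -> 'I_n -> R) (f g h : R) : R :=
  \sum_(i < n) \sum_(j < n) \sum_(l < n) \sum_(m < n)
    D m (D i f) * D j g * D l h * (P i j * P' m l).

Section CommutingDerivations.
Context {R : comPzRingType} {n : nat} (D : 'I_n -> R -> R).
Hypothesis DD : forall i f g, D i (f + g) = D i f + D i g.
Hypothesis DM : forall i f g, D i (f * g) = D i f * g + f * D i g.
Hypothesis DC : forall i j f, D i (D j f) = D j (D i f).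
Implicit Types (P : 'I_n -> 'I_n -> R) (f g h : R).

Lemma derivation0 i : D i 0 = 0.
Proof. by apply: (addrI (D i 0)); rewrite -DD !addr0. Qed.

Lemma derivation_sum i (I : finType) (F : I -> R) :
  D i (\sum_a F a) = \sum_a D i (F a).
Proof. exact: (big_morph (D i) (DD i) (derivation0 i)). Qed.

(** Exchange the names of i and m, and of j and l; the second derivative of f is unaffected because
    the derivations commute. *)
Lemma deriv_arg_swap P P' f g h :
  deriv_arg D P' P f h g = deriv_arg D P P' f g h.
Proof.
rewrite /deriv_arg.
transitivity (\sum_(m < n) \sum_(l < n) \sum_(j < n) \sum_(i < n)
    D m (D i f) * D j g * D l h * (P i j * P' m l)).
  do 4! [apply: eq_bigr => ? _]; rewrite DC; ring.
rewrite exchange_big /=.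
under eq_bigr => l _.
  rewrite exchange_big; under eq_bigr => j _ do rewrite exchange_big.
  over.
rewrite exchange_big; under eq_bigr => j _ do rewrite exchange_big.
exact: exchange_big.
Qed.

(** The Leibniz rule gives three terms. Antisymmetry of P turns the one differentiating [D j g] into
    minus the one differentiating [D i f], with f and g exchanged. *)
Lemma biderivation_comp P P' f g h : (forall i j, P j i = - P i j) ->
  biderivation D P' (biderivation D P f g) h =
  deriv_coef D P P' f g h + (deriv_arg D P P' f g h - deriv_arg D P P' g f h).
Proof.
move=> PN.
have -> : deriv_arg D P P' g f h = - \sum_(i < n) \sum_(j < n) \sum_(l < n)
    \sum_(m < n) D i f * D m (D j g) * D l h * (P i j * P' m l).
  rewrite /deriv_arg exchange_big /= -sumrN; apply: eq_bigr => i _.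
  rewrite -sumrN; apply: eq_bigr => j _; rewrite -sumrN; apply: eq_bigr => l _.
  rewrite -sumrN; apply: eq_bigr => m _; rewrite (PN i j); ring.
rewrite opprK -!big_split /biderivation exchange_big /=.
under eq_bigr => l _.
  under eq_bigr => m _.
    rewrite derivation_sum !mulr_suml.
    under eq_bigr => i _.
      rewrite derivation_sum !mulr_suml.
      under eq_bigr => j _ do rewrite !DM.
      over.
    over.
  rewrite exchange_big; under eq_bigr => i _ do rewrite exchange_big.
  over.
rewrite exchange_big; apply: eq_bigr => i _.
rewrite exchange_big -!big_split; apply: eq_bigr => j _.
rewrite -!big_split; apply: eq_bigr => l _.
rewrite -!big_split; apply: eq_bigr => m _.
rewrite /=; ring.
Qed.

(** Over the cyclic sum the [deriv_arg] terms cancel in pairs by [deriv_arg_swap], so the bracket is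
    of first order in each argument. *)
Lemma schouten_biderivation P P' f g h :
  (forall i j, P j i = - P i j) -> (forall i j, P' j i = - P' i j) ->
  let B1 := biderivation D P in let B2 := biderivation D P' in
  (B2 (B1 f g) h + B1 (B2 f g) h) +
  (B2 (B1 g h) f + B1 (B2 g h) f) +
  (B2 (B1 h f) g + B1 (B2 h f) g) =
  (deriv_coef D P P' f g h + deriv_coef D P' P f g h) +
  (deriv_coef D P P' g h f + deriv_coef D P' P g h f) +
  (deriv_coef D P P' h f g + deriv_coef D P' P h f g).
Proof.
move=> PN P'N B1 B2; rewrite /B1 /B2 !biderivation_comp //.
rewrite !(deriv_arg_swap P P'); ring.
Qed.

End CommutingDerivations.

(** * The bracket in dimension four as a Jacobian *)

Lemma sum4E {R : comPzRingType} (F : 'I_4 -> R) :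
  \sum_i F i = F o0 + F o1 + F o2 + F o3.
Proof. by rewrite !big_ord_recl big_ord0 addr0 !addrA. Qed.

(** The cyclic sum T of t is alternating, so only increasing index triples survive. Vanishing on the
    diagonal is assumed separately since 2 may be a zero divisor in R. *)
Lemma alternating_sum4 {R : comPzRingType} (t : 'I_4 -> 'I_4 -> 'I_4 -> R)
    (u v w : 'I_4 -> R) :
  (forall i l, t i i l = 0) -> (forall i j l, t j i l = - t i j l) ->
  let T i j l := t i j l + t j l i + t l i j in
  let S u v w := \sum_i \sum_j \sum_l u i * v j * w l * t i j l in
  S u v w + S v w u + S w u v =
    T o0 o1 o2 * minor3 u v w o0 o1 o2 + T o0 o1 o3 * minor3 u v w o0 o1 o3 +
    T o0 o2 o3 * minor3 u v w o0 o2 o3 + T o1 o2 o3 * minor3 u v w o1 o2 o3.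
Proof.
move=> t0 tN T S; rewrite /T /S /minor3 !sum4E !t0.
rewrite !(tN o0 o1) !(tN o0 o2) !(tN o0 o3) !(tN o1 o2) !(tN o1 o3) !(tN o2 o3).
ring.
Qed.

(* dx_i /\ dx_j /\ u /\ v / vol for 1-forms u and v. *)
Definition bivec_coef {R : comPzRingType} (u v : 'I_4 -> R) (i j : 'I_4) : R :=
  \det (\matrix_(a, b) tnth [tuple (fun b => (i == b)%:R);
                                   (fun b => (j == b)%:R); u; v] a b).

Lemma bivec_coefC {R : comPzRingType} (u v : 'I_4 -> R) i j :
  bivec_coef u v j i = - bivec_coef u v i j.
Proof. rewrite /bivec_coef !det4E /minor3; ring. Qed.

Lemma bivec_coef_diag {R : comPzRingType} (u v : 'I_4 -> R) i :
  bivec_coef u v i i = 0.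
Proof. rewrite /bivec_coef !det4E /minor3; ring. Qed.

(** These are the complementary Plücker coordinates; the index orders [o3 o1] and [o2 o0] absorb the
    signs. *)
Lemma bivec_coefE {R : comPzRingType} (u v : 'I_4 -> R) :
  let p i j := u i * v j - u j * v i in
  let P := bivec_coef u v in
  ([/\ P o0 o1 = p o2 o3, P o0 o2 = p o3 o1 & P o0 o3 = p o1 o2] *
   [/\ P o1 o2 = p o0 o3, P o1 o3 = p o2 o0 & P o2 o3 = p o0 o1])%type.
Proof.
move=> p P; rewrite /P /bivec_coef !det4E /minor3 /=.
by split; split; rewrite /p; ring.
Qed.

Section Jacobian.
Context {R : comPzRingType} (D : 'I_4 -> R -> R).
Hypothesis DD : forall i f g, D i (f + g) = D i f + D i g.
Hypothesis DM : forall i f g, D i (f * g) = D i f * g + f * D i g.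
Hypothesis DC : forall i j f, D i (D j f) = D j (D i f).

Lemma derivationN i f : D i (- f) = - D i f.
Proof. by apply/eqP; rewrite -addr_eq0 -DD addNr (derivation0 D DD). Qed.

Definition jacobian (f1 f2 f3 f4 : R) : R :=
  \det (\matrix_(a, b) tnth [tuple D^~ f1; D^~ f2; D^~ f3; D^~ f4] a b).

Lemma derivation_det (u1 u2 u3 u4 : 'I_4 -> R) m :
  let J (u1 u2 u3 u4 : 'I_4 -> R) :=
    \det (\matrix_(a, b) tnth [tuple u1; u2; u3; u4] a b) in
  D m (J u1 u2 u3 u4) =
    J (D m \o u1) u2 u3 u4 + J u1 (D m \o u2) u3 u4 +
    J u1 u2 (D m \o u3) u4 + J u1 u2 u3 (D m \o u4).
Proof.
rewrite /= !det4E /minor3 /=; rewrite !(DM, DD, derivationN); ring.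
Qed.

(** Conceptually, P and P' are divergence-free because the dual 2-forms are closed, so their bracket
    is, up to sign, the divergence of their wedge product, which is F times the standard
    4-vector. *)
Lemma schouten_coefE q1 q2 q3 q4 :
  let P := bivec_coef (D^~ q1) (D^~ q2) in
  let P' := bivec_coef (D^~ q3) (D^~ q4) in
  let t i j l := \sum_m (D m (P i j) * P' m l + D m (P' i j) * P m l) in
  let T i j l := t i j l + t j l i + t l i j in
  let F := jacobian q1 q2 q3 q4 in
  ((T o0 o1 o2 = - D o3 F) * (T o0 o1 o3 = D o2 F) *
   (T o0 o2 o3 = - D o1 F) * (T o1 o2 o3 = D o0 F))%type.
Proof.
move=> P P' t T F.
have D2 m a b c d : D m (a * b - c * d) =
    D m a * b + a * D m b - (D m c * d + c * D m d).
  by rewrite DD derivationN !DM.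
rewrite /T /t !sum4E /P /P' !bivec_coef_diag.
rewrite !(bivec_coefC _ _ o0 o1) !(bivec_coefC _ _ o0 o2).
rewrite !(bivec_coefC _ _ o0 o3) !(bivec_coefC _ _ o1 o2).
rewrite !(bivec_coefC _ _ o1 o3) !(bivec_coefC _ _ o2 o3).
case: (bivec_coefE (D^~ q1) (D^~ q2)) => [[-> -> ->] [-> -> ->]].
case: (bivec_coefE (D^~ q3) (D^~ q4)) => [[-> -> ->] [-> -> ->]].
rewrite /F /jacobian !derivation_det !det4E /minor3 /=.
rewrite !D2 !derivationN !D2.
(* Mixed second derivatives are atoms for [ring], so they are brought to one order. *)
rewrite !(DC o1 o0) !(DC o2 o0) !(DC o3 o0) !(DC o2 o1) !(DC o3 o1) !(DC o3 o2).
split; [split; [split|]|]; ring.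
Qed.

Lemma schouten_jacobian q1 q2 q3 q4 f g h :
  let B1 := biderivation D (bivec_coef (D^~ q1) (D^~ q2)) in
  let B2 := biderivation D (bivec_coef (D^~ q3) (D^~ q4)) in
  (B2 (B1 f g) h + B1 (B2 f g) h) +
  (B2 (B1 g h) f + B1 (B2 g h) f) +
  (B2 (B1 h f) g + B1 (B2 h f) g) = - jacobian f g h (jacobian q1 q2 q3 q4).
Proof.
move=> B1 B2; rewrite /B1 /B2 schouten_biderivation //; try exact: bivec_coefC.
set P := bivec_coef _ _; set P' := bivec_coef _ _.
pose t i j l := \sum_m (D m (P i j) * P' m l + D m (P' i j) * P m l).
have tE u v w : deriv_coef D P P' u v w + deriv_coef D P' P u v w =
    \sum_i \sum_j \sum_l D i u * D j v * D l w * t i j l.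
  rewrite /deriv_coef -big_split; apply: eq_bigr => i _.
  rewrite -big_split; apply: eq_bigr => j _.
  rewrite -big_split; apply: eq_bigr => l _.
  by rewrite -big_split /= mulr_sumr; apply: eq_bigr => m _; rewrite mulrDr.
rewrite !tE (alternating_sum4 t (D^~ f) (D^~ g) (D^~ h)).
(* The four terms are those of minus the Jacobian expanded along its last row, that of F. *)
- rewrite !schouten_coefE /jacobian (det4E (D^~ f) (D^~ g)) /minor3; ring.
- move=> i l; rewrite /t big1 // => m _.
  by rewrite /P /P' !bivec_coef_diag (derivation0 D DD) !mul0r addr0.
- move=> i j l; rewrite /t -sumrN; apply: eq_bigr => m _.
  by rewrite /P /P' !(bivec_coefC _ _ i j) !derivationN !mulNr opprD.
Qed.

End Jacobian.

(** * Euler's identity and homogeneity *)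

(** Replacing column 0 by the combination of all columns with weights x leaves only its last entry,
    whose cofactor carries the minus sign. *)
Lemma det4_euler {R : comPzRingType} (x u v w s : 'I_4 -> R) :
  \sum_i x i * u i = 0 -> \sum_i x i * v i = 0 -> \sum_i x i * w i = 0 ->
  x o0 * \det (\matrix_(a, b) tnth [tuple u; v; w; s] a b) =
  - (\sum_i x i * s i) * minor3 u v w o1 o2 o3.
Proof.
move=> xu xv xw.
(* Cramer's rule for the column 0 of the matrix. *)
transitivity ((\sum_i x i * u i) * minor3 v w s o1 o2 o3
  - (\sum_i x i * v i) * minor3 u w s o1 o2 o3
  + (\sum_i x i * w i) * minor3 u v s o1 o2 o3
  - (\sum_i x i * s i) * minor3 u v w o1 o2 o3).
  by rewrite det4E /minor3 !sum4E; ring.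
rewrite xu xv xw; ring.
Qed.

Lemma minor3_scale {R : comPzRingType} {n} (c : R) (u v w : 'I_n -> R) i j l :
  minor3 (fun a => c * u a) (fun a => c * v a) (fun a => c * w a) i j l =
  c ^+ 3 * minor3 u v w i j l.
Proof. rewrite /minor3; ring. Qed.

Lemma mpoly_euler {R : comNzRingType} {n d : nat} {p : {mpoly R[n]}} :
  p \is d.-homog -> \sum_(i < n) 'X_i * p^`M(i) = p *+ d.
Proof.
move=> /dhomogP hp; rewrite [in RHS](mpolyE p) -sumrMnl.
under eq_bigr => i _.
  rewrite {1}(mpolyE p) raddf_sum mulr_sumr; over.
rewrite exchange_big big_seq [RHS]big_seq; apply: eq_bigr => m /hp <- /=.
rewrite mdegE -sumrMnr; apply: eq_bigr => i _.
rewrite mderivZ mderivX -!scalerAr scaler_nat -scalerMnr.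
(* Subtraction of exponents is truncated; when the exponent of ['X_i] is 0 the term has coefficient
   0 anyway. *)
case: (posnP (m i)) => [->|mi]; first by rewrite !mulr0n.
rewrite -mpolyXD addmC submK //.
by apply/mnm_lepP => j; rewrite mnm1E; case: eqP => // <-.
Qed.

Lemma dhomog_mderiv {R : comNzRingType} {n d : nat} i {p : {mpoly R[n]}} :
  p \is d.+1.-homog -> p^`M(i) \is d.-homog.
Proof.
move=> hp; apply/dhomogP => m; rewrite mcoeff_msupp mcoeff_deriv.
apply: contraNeq => md.
rewrite (dhomog_nemf_coeff hp) ?mul0rn //=.
by rewrite mdegD mdeg1 addn1 eqSS.
Qed.

(** * Extending derivations to fractions *)

Section QuotientRule.
Context {R : comPzRingType} {F : fieldType} (phi : {rmorphism R -> F}).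
Context (d d' : R -> R) (D D' : F -> F).
Hypothesis fracP : forall f, exists p q, phi q != 0 /\ f = phi p / phi q.
Hypotheses (dD : {morph d : p q / p + q}) (d'D : {morph d' : p q / p + q}).
Hypotheses (dN : {morph d : p / - p}) (d'N : {morph d' : p / - p}).
Hypothesis dM : forall p q, d (p * q) = d p * q + p * d q.
Hypothesis d'M : forall p q, d' (p * q) = d' p * q + p * d' q.
Hypothesis DE : forall p q, phi q != 0 ->
  D (phi p / phi q) = phi (d p * q - p * d q) / phi (q ^+ 2).
Hypothesis D'E : forall p q, phi q != 0 ->
  D' (phi p / phi q) = phi (d' p * q - p * d' q) / phi (q ^+ 2).

Lemma quotient_ruleD f g : D (f + g) = D f + D g.
Proof.
have [p [q [q0 ->]]] := fracP f; have [p' [q' [q'0 ->]]] := fracP g.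
rewrite addf_div // -!rmorphM -rmorphD !DE ?rmorphM ?mulf_neq0 //.
rewrite dD !dM !(rmorphXn, rmorphB, rmorphD, rmorphM) /=.
by field; rewrite q0 q'0.
Qed.

Lemma quotient_ruleM f g : D (f * g) = D f * g + f * D g.
Proof.
have [p [q [q0 ->]]] := fracP f; have [p' [q' [q'0 ->]]] := fracP g.
rewrite mulf_div -!rmorphM !DE ?rmorphM ?mulf_neq0 //.
rewrite !dM !(rmorphXn, rmorphB, rmorphD, rmorphM) /=.
by field; rewrite q0 q'0.
Qed.

Lemma quotient_ruleC f : (forall p, d (d' p) = d' (d p)) -> D (D' f) = D' (D f).
Proof.
move=> dC; have [p [q [q0 ->]]] := fracP f.
have q20 : phi (q ^+ 2) != 0 by rewrite rmorphXn expf_neq0.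
rewrite (DE p q) // (D'E p q) // DE // D'E //.
rewrite !expr2 !(dD, d'D, dN, d'N, dM, d'M) !dC.
by rewrite !(rmorphN, rmorphB, rmorphD, rmorphM) /=; field.
Qed.

End QuotientRule.

(** * The bracket on rational functions *)

Section FractionDerivations.
Context {k : fieldType}.
Local Notation S := {mpoly k[4]}.
Local Notation K := {fraction S}.
Implicit Types (p q : S) (f g h : K).

Lemma fracP f : exists p q : S, q%:F != 0 :> K /\ f = p%:F / q%:F.
Proof.
exists (\n_(repr f)), (\d_(repr f)); split; last exact: numden_repr.
by rewrite tofrac_eq0 denom_ratioP.
Qed.

Lemma frac_deriv_quotient i p q : q%:F != 0 :> K ->
  frac_deriv i (p%:F / q%:F) = (p^`M(i) * q - p * q^`M(i))%:F / (q ^+ 2)%:F.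
Proof. by rewrite tofrac_eq0; exact: frac_derivE. Qed.

Lemma frac_derivD i f g :
  frac_deriv i (f + g) = frac_deriv i f + frac_deriv i g.
Proof.
exact: (quotient_ruleD (@FracField.tofrac S) _ _ fracP
         (mderivD i) (mderivM i) (frac_deriv_quotient i)).
Qed.

Lemma frac_derivM i f g :
  frac_deriv i (f * g) = frac_deriv i f * g + f * frac_deriv i g.
Proof.
exact: (quotient_ruleM (@FracField.tofrac S) _ _ fracP
         (mderivM i) (frac_deriv_quotient i)).
Qed.

Lemma frac_derivC i j f :
  frac_deriv i (frac_deriv j f) = frac_deriv j (frac_deriv i f).
Proof.
apply: (quotient_ruleC (@FracField.tofrac S) _ _ _ _ fracP
         (mderivD i) (mderivD j) (mderivN i) (mderivN j) (mderivM i) (mderivM j)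
         (frac_deriv_quotient i) (frac_deriv_quotient j)).
exact: mderiv_comm.
Qed.

(** By Euler's identity the numerator of the quotient rule becomes d p q - d p q. *)
Lemma degree0_euler f : degree0 f ->
  \sum_(i < 4) ('X_i)%:F * frac_deriv i f = 0.
Proof.
case=> d [p [q [hp hq q0 ->]]].
under eq_bigr => i _ do rewrite frac_derivE // mulrA -tofracM.
rewrite -mulr_suml -raddf_sum /=.
under eq_bigr => i _ do rewrite mulrBr mulrA mulrCA.
rewrite sumrB -mulr_suml -mulr_sumr !(mpoly_euler (d := d)) //.
by rewrite mulrnAl mulrnAr subrr tofrac0 mul0r.
Qed.

Lemma wedge_d_tofrac p1 p2 p3 p4 :
  (wedge_d [tuple p1; p2; p3; p4])%:F =
  jacobian (@frac_deriv k) p1%:F p2%:F p3%:F p4%:F.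
Proof.
rewrite /jacobian -det_map_mx; congr (\det _); apply/matrixP => a b.
rewrite !mxE; case: a => [[|[|[|[|?]]]] ?] //=;
  exact/esym/frac_deriv_tofrac.
Qed.

Lemma bracket_biderivation q1 q2 f g :
  bracket q1 q2 f g = biderivation (@frac_deriv k)
    (bivec_coef ((@frac_deriv k)^~ q1%:F) ((@frac_deriv k)^~ q2%:F)) f g.
Proof.
apply: eq_bigr => i _; apply: eq_bigr => j _; congr (_ * _).
rewrite wedge_d_tofrac /jacobian /bivec_coef !det4E /minor3.
by rewrite !frac_deriv_tofrac !mderivXU !rmorph_nat.
Qed.

Lemma schouten_bracket q1 q2 q3 q4 f g h :
  schouten (bracket q1 q2) (bracket q3 q4) f g h =
  - jacobian (@frac_deriv k) f g h (wedge_d [tuple q1; q2; q3; q4])%:F.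
Proof.
rewrite wedge_d_tofrac -schouten_jacobian.
- by rewrite /schouten !bracket_biderivation.
- exact: frac_derivD.
- exact: frac_derivM.
- exact: frac_derivC.
Qed.

Lemma schouten_bracket_quartic q1 q2 q3 q4 :
  wedge_d [tuple q1; q2; q3; q4] \is 4.-homog ->
  corresponds_to_quartic (schouten (bracket q1 q2) (bracket q3 q4))
    (4%:R *: wedge_d [tuple q1; q2; q3; q4]).
Proof.
set F := wedge_d _ => homF; split=> [|f g h f0 g0 h0]; first exact: dhomogZ.
have x0 : ('X_ord0)%:F != 0 :> K.
  by rewrite tofrac_eq0 -msize_poly_eq0 msizeX mdeg1.
(* The factor x_1 is what [det4_euler] needs on the left of the Jacobian. *)
apply: (mulfI x0); rewrite schouten_bracket mulrN.
rewrite (det4_euler (fun i => ('X_i)%:F)); [|exact: degree0_euler..].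
under eq_bigr do rewrite frac_deriv_tofrac -tofracM.
rewrite -raddf_sum (mpoly_euler homF) /= -scaler_nat.
have -> : \det (\matrix_(a < 3, b < 3)
      affine_deriv b (tnth [tuple f; g; h] a)) =
    \det (\matrix_(a, b) tnth [tuple (@affine_deriv k)^~ f;
      (@affine_deriv k)^~ g; (@affine_deriv k)^~ h] a b).
  congr (\det _); apply/matrixP => a b.
  by rewrite !mxE; case: a => [[|[|[|?]]] ?].
rewrite det3E tofracXn.
(* Each of the three affine derivatives contributes a factor x_1, and the last x_1 was multiplied in
   above; together they cancel x_1^4. *)
have cancel (L : fieldType) (x c M : L) : x != 0 ->
    - (- c * M) = x * (c / x ^+ 4 * (x ^+ 3 * M)).
  by move=> ?; field.
rewrite (cancel _ _ _ _ x0); congr (_ * (_ * _)).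
by rewrite minor3_scale.
Qed.

End FractionDerivations.

(** * Identification of the Jacobian with [Phi] *)

Lemma Phi_wedge_d {k : fieldType} {V : vectType k} (e : 4.-tuple V)
    Q1 Q2 Q3 Q4 :
  Phi e Q1 Q2 Q3 Q4 =
  wedge_d [tuple quad_poly e Q1; quad_poly e Q2;
                 quad_poly e Q3; quad_poly e Q4].
Proof.
have gradE Q b : (quad_poly e Q)^`M(b) =
    \sum_(i < 4) ((quad_poly e Q)^`M(i))@_U_(b) *: 'X_i.
  have /(dhomog_mderiv (d := 1) b) := quad_poly_homog e Q.
  move: (quad_poly e Q) => q homq; rewrite -[LHS]mulr1n -(mpoly_euler homq).
  apply: eq_bigr => i _; rewrite mulrC -mul_mpolyC; congr (_ * _).
  have homc := dhomog_mderiv (d := 0) i homq.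
  (* The second derivative is constant, so only m = 0 matters; there the symmetry of the Hessian
     exchanges b and i. *)
  apply/mpolyP => m; rewrite mcoeffC; have [->|m0] := eqVneq m 0%MM.
    by rewrite mderiv_comm (mcoeff_deriv b) add0m mnm0E mulr1n mulr1.
  by rewrite (dhomog_nemf_coeff homc) ?mulr0 //= mdeg_eq0.
congr (\det _); apply/matrixP => a b; rewrite !mxE.
by case: a => [[|[|[|[|?]]]] ?] //=; rewrite -gradE.
Qed.

Theorem theoremD (k : closedFieldType) (char0 : [pchar k] =i pred0)
    (V : vectType k) (dimV : \dim (fullv : {vspace V}) = 4%N)
    (e : 4.-tuple V) (basis_e : basis_of fullv e)
    (Q1 Q2 Q3 Q4 : V -> k)
    (hQ1 : quadratic_form Q1) (hQ2 : quadratic_form Q2)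
    (hQ3 : quadratic_form Q3) (hQ4 : quadratic_form Q4) :
  corresponds_to_quartic (schouten (Pi e Q1 Q2) (Pi e Q3 Q4))
    (4%:R *: Phi e Q1 Q2 Q3 Q4).
Proof.
rewrite Phi_wedge_d; apply: schouten_bracket_quartic.
by rewrite -Phi_wedge_d; exact: Phi_homog.
Qed.
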